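(* For graphs $G_1,\ldots,G_d$, $$\mathrm{boxicity}\left(\times_{i=1}^d G_i\right) \leq \sum_{i=1}^d\left(\mathrm{boxicity}(G_i)+\chi(G_i)\right).$$
   Context: All graphs are finite, undirected and simple. $\chi(G)$ denotes the chromatic number of $G$. A $k$-box is a Cartesian product of $k$ closed intervals of $\mathbb{R}$. The boxicity of a graph $G$ is the smallest natural number $k$ (with $0$ allowed; complete graphs have boxicity $0$) such that there is a function $f$ mapping each vertex of $G$ to a $k$-box so that any two distinct vertices $u,v$ are adjacent in $G$ iff $f(u)\cap f(v)\neq\emptyset$. The direct product $G_1\times G_2$ is the graph on $V(G_1)\times V(G_2)$ in which $(u_1,u_2)$ and $(v_1,v_2)$ are adjacent iff $u_1v_1\in E(G_1)$ and $u_2v_2\in E(G_2)$; $\times_{i=1}^d$ denotes the iterated direct product. *)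

(* Defs.v *)
From HB Require Import structures.
From mathcomp Require Import all_boot all_order all_algebra.
From mathcomp Require Import boolp classical_sets reals.

Set Implicit Arguments.
Unset Strict Implicit.
Unset Printing Implicit Defensive.

Import Order.TTheory GRing.Theory Num.Theory.

Local Open Scope ring_scope.
Local Open Scope classical_set_scope.

Record sgraph := SGraph {
  vertex :> finType;
  adj : rel vertex;
  adj_sym : symmetric adj;
  adj_irr : irreflexive adj
}.

Definition colorable (G : sgraph) (k : nat) : bool :=
  [exists c : {ffun G -> 'I_k}, forall u, forall v, adj u v ==> (c u != c v)].

Lemma colorable_ex (G : sgraph) : exists k, colorable G k.
Proof.
exists #|G|; apply/existsP; exists [ffun v => enum_rank v].
apply/forallP => u; apply/forallP => v; apply/implyP => uv.
rewrite !ffunE; apply/eqP => /enum_rank_inj E.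
by move: uv; rewrite E adj_irr.
Qed.

Definition chromatic_number (G : sgraph) : nat := ex_minn (colorable_ex G).

(* The intervals are nonempty; the only 0-box is the one-point space. *)
Definition is_box (R : realType) (k : nat) (B : set ('I_k -> R)) : Prop :=
  exists a b : 'I_k -> R,
    (forall i, a i <= b i) /\ B = [set x | forall i, a i <= x i <= b i].

Definition box_representable (R : realType) (G : sgraph) (k : nat) : Prop :=
  exists f : G -> set ('I_k -> R),
    (forall v, is_box (f v)) /\
    (forall u v, u != v -> (adj u v <-> f u `&` f v !=set0)).

(* One coordinate per vertex w: w gets [0, 0], its neighbours [0, 1], all
   other vertices [1, 1]. *)
Lemma box_representable_ex (R : realType) (G : sgraph) :
  exists k, `[< box_representable R G k >].
Proof.
exists #|G|; apply/asboolP.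
pose a (v : G) (i : 'I_#|G|) : R :=
  ((enum_val i != v) && ~~ adj (enum_val i) v)%:R.
pose b (v : G) (i : 'I_#|G|) : R := (enum_val i != v)%:R.
exists (fun v => [set x | forall i, a v i <= x i <= b v i]); split.
  move=> v; exists (a v), (b v); split => // i.
  by rewrite /a /b ler_nat; case: (_ != v); case: (adj _ _).
move=> u v uv; split=> [e|[x [/= xu xv]]].
  exists (fun i => ((enum_val i != u) && (enum_val i != v))%:R).
  split=> i; rewrite /= /a /b !ler_nat.
    case: (eqVneq (enum_val i) u) => //= _.
    by case: (eqVneq (enum_val i) v) => [->|]; rewrite 1?adj_sym ?e // ?leq_b1.
  case: (eqVneq (enum_val i) v) => //= _; first by rewrite andbF.
  by case: (eqVneq (enum_val i) u) => [->|]; rewrite ?e //= ?leq_b1.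
apply/negPn/negP => nuv.
move: (xu (enum_rank u)) (xv (enum_rank u)).
rewrite /= /a /b !enum_rankK eqxx uv nuv /= => /andP[_ x0] /andP[x1 _].
by move: (le_trans x1 x0); rewrite ler10.
Qed.

Definition boxicity (R : realType) (G : sgraph) : nat :=
  ex_minn (box_representable_ex R G).

Section DirectProduct.
Variables G H : sgraph.

Definition dprod_adj : rel (G * H)%type :=
  fun u v => adj u.1 v.1 && adj u.2 v.2.

Lemma dprod_adj_sym : symmetric dprod_adj.
Proof. by move=> u v; rewrite /dprod_adj adj_sym [adj u.2 _]adj_sym. Qed.

Lemma dprod_adj_irr : irreflexive dprod_adj.
Proof. by move=> u; rewrite /dprod_adj adj_irr. Qed.

Definition direct_product : sgraph := SGraph dprod_adj_sym dprod_adj_irr.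

End DirectProduct.

(* The product (...(G_0 x G_1) x ...) x G_d of a nonempty family; an empty
   product would be a single looped vertex, which is not a simple graph. *)
Fixpoint iter_direct_product (d : nat) : ('I_d.+1 -> sgraph) -> sgraph :=
  if d is d'.+1 then fun G =>
    direct_product
      (iter_direct_product (fun i : 'I_d'.+1 => G (widen_ord (leqnSn d'.+1) i)))
      (G ord_max)
  else fun G => G ord0.

(* Main.v *)
(** An edge of the product projects to an edge of every factor.  For each
    factor [G i], the boxes of an optimal representation of [G i], pulled back
    along the i-th projection, separate the pairs whose i-th projections are
    distinct and non-adjacent.  The remaining non-adjacent pairs have equal i-th
    projections for some [i]; they are separated by one interval per colour
    [c] of [G i]: the vertices whose i-th projection has colour [c] get distinct
    points, and all other vertices an interval containing these points.  This
    destroys no edge, as adjacent vertices have different colours. *)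
Require Import Defs.
From mathcomp Require Import all_boot all_order all_algebra.
From mathcomp Require Import boolp classical_sets reals.

Set Implicit Arguments.
Unset Strict Implicit.
Unset Printing Implicit Defensive.

Import Order.TTheory GRing.Theory Num.Theory.

(** The coordinatewise maximum of the left endpoints is a common point. *)
Lemma box_meetP (R : realType) (k : nat) (a b a' b' : 'I_k -> R) :
  (forall i, a i <= b i)%R -> (forall i, a' i <= b' i)%R ->
  (([set x | forall i, a i <= x i <= b i] `&`
    [set x | forall i, a' i <= x i <= b' i])%R !=set0)%classic <->
  (forall i, (a i <= b' i) && (a' i <= b i))%R.
Proof.
move=> ab ab'; split=> [[x [/= xab xab']] i|meet].
  case/andP: (xab i) (xab' i) => ax xb /andP[a'x xb'].
  by rewrite (le_trans ax xb') (le_trans a'x xb).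
exists (fun i => Order.max (a i) (a' i)); split=> i /=;
  by case/andP: (meet i) => ab'i a'bi;
     rewrite le_max lexx ?orbT ge_max ?ab ?ab' ?ab'i ?a'bi.
Qed.

(** Indexing the coordinates by any finite type allows one coordinate per box dimension and per
    colour of each factor, without arithmetic on ordinals. *)
Lemma boxicity_le_card (R : realType) (G : sgraph) (T : finType)
    (a b : G -> T -> R) :
  (forall v t, a v t <= b v t)%R ->
  (forall u v, u != v ->
     adj u v <-> forall t, ((a u t <= b v t) && (a v t <= b u t))%R) ->
  boxicity R G <= #|T|.
Proof.
move=> ab adjP; rewrite /boxicity; case: ex_minnP => m _; apply.
apply/asboolP.
exists (fun v => [set x : 'I_#|T| -> R |
  forall i, a v (enum_val i) <= x i <= b v (enum_val i)]%R%classic); split.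
  by move=> v; exists (a v \o enum_val), (b v \o enum_val); split=> // i /=.
move=> u v /adjP ->; rewrite box_meetP; try by move=> i; exact: ab.
split=> [meet i|meet t]; first exact: meet.
by move: (meet (enum_rank t)); rewrite enum_rankK.
Qed.

Lemma boxicity_intervals (R : realType) (G : sgraph) :
  exists ab : (G -> 'I_(boxicity R G) -> R) * (G -> 'I_(boxicity R G) -> R),
  (forall v i, ab.1 v i <= ab.2 v i)%R /\
  (forall u v, u != v ->
     adj u v <-> forall i, ((ab.1 u i <= ab.2 v i) && (ab.1 v i <= ab.2 u i))%R).
Proof.
rewrite /boxicity; case: ex_minnP => m /asboolP[f [f_box adjP]] _.
have [a a_box] := choice f_box; have [b ab_box] := choice a_box.
exists (a, b); split=> [v|u v /adjP ->]; first by case: (ab_box v).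
have [[abu ->] [abv ->]] := (ab_box u, ab_box v).
exact: box_meetP.
Qed.

Lemma chromatic_number_coloring (G : sgraph) :
  exists c : G -> 'I_(chromatic_number G), forall u v, adj u v -> c u != c v.
Proof.
rewrite /chromatic_number; case: ex_minnP => m /existsP[c /forallP c_col] _.
by exists c => u v; move/forallP: (c_col u) => /(_ v)/implyP.
Qed.

(* [E i] is adjacency of the i-th projections.  Describing it as a relation
   first spares the casts in an explicit projection to [G i]. *)
Lemma iter_direct_product_adj (d : nat) (G : 'I_d.+1 -> sgraph) :
  exists E : 'I_d.+1 -> rel (iter_direct_product G),
  (forall u v, adj u v <-> forall i, E i u v) /\
  (forall i, exists p : iter_direct_product G -> G i,
     forall u v, E i u v = adj (p u) (p v)).
Proof.
elim: d G => [|d IHd] G.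
  exists (fun _ u v => adj u v); split=> [u v|i].
    by split=> [|/(_ ord0)].
  by rewrite (ord1 i); exists id.
have [E [adjE E_proj]] := IHd (fun i => G (widen_ord (leqnSn d.+1) i)).
(* [insub] succeeds exactly when [i] indexes a factor of the left component; it fails only at
   [ord_max]. *)
pose E' (i : 'I_d.+2) (u v : iter_direct_product G) :=
  if insub (val i) is Some j then E j u.1 v.1 else adj u.2 v.2.
have E'w j : E' (widen_ord (leqnSn d.+1) j) = fun u v => E j u.1 v.1.
  by rewrite /E' /= valK.
have E'm : E' ord_max = fun u v => adj u.2 v.2.
  by rewrite /E' insubF ?ltnn.
have ordP (i : 'I_d.+2) : i = ord_max \/ exists j, i = widen_ord (leqnSn d.+1) j.
  have [i_lt|i_ge] := ltnP i d.+1.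
    by right; exists (Ordinal i_lt); apply: val_inj.
  by left; apply/val_inj/eqP; rewrite eqn_leq i_ge -ltnS ltn_ord.
exists E'; split=> [u v|i].
  split=> [/andP[/adjE E1 adj2] i|E'uv].
    by case: (ordP i) => [->|[j ->]]; rewrite ?E'm ?E'w.
  apply/andP; split; last by move: (E'uv ord_max); rewrite E'm.
  by apply/adjE => j; move: (E'uv (widen_ord (leqnSn d.+1) j)); rewrite E'w.
case: (ordP i) => [->|[j ->]]; first by exists snd => u v; rewrite E'm.
by have [p pE] := E_proj j; exists (p \o fst) => u v; rewrite E'w pE.
Qed.

(** Stated for any graph whose adjacency is read off from maps to the factors, so that the recursive
    shape of the product does not enter. *)
Lemma boxicity_le_sum_factors (R : realType) (I : finType) (G : I -> sgraph)
    (K : sgraph) (p : forall i, K -> G i) :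
  (forall u v, adj u v <-> forall i, adj (p i u) (p i v)) ->
  boxicity R K <= \sum_i (boxicity R (G i) + chromatic_number (G i)).
Proof.
move=> adjP.
pose ab i := projT1 (cid (boxicity_intervals R (G i))).
have [ab_le ab_adj] := all_and2 (fun i => projT2 (cid (boxicity_intervals R (G i)))).
pose c i := projT1 (cid (chromatic_number_coloring (G i))).
have c_col i : forall u v, adj u v -> c i u != c i v.
  exact: projT2 (cid (chromatic_number_coloring (G i))).
pose T := {i : I & ('I_(boxicity R (G i)) + 'I_(chromatic_number (G i)))%type}.
(* In the coordinate of colour [x], a vertex of that colour gets its rank as a single point, any
   other the interval from 0 to [#|K|], which contains all ranks. *)
pose lo v (t : T) : R := match tagged t with
  | inl j => (ab (tag t)).1 (p (tag t) v) j
  | inr x => if c (tag t) (p (tag t) v) == x then (enum_rank v)%:R else 0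
  end%R.
pose hi v (t : T) : R := match tagged t with
  | inl j => (ab (tag t)).2 (p (tag t) v) j
  | inr x => if c (tag t) (p (tag t) v) == x then (enum_rank v)%:R else #|K|%:R
  end%R.
have -> : \sum_i (boxicity R (G i) + chromatic_number (G i)) = #|{: T}|.
  rewrite card_tagged sumnE big_map big_enum.
  by apply: eq_bigr => i _; rewrite card_sum !card_ord.
have rank_le (v : K) : enum_rank v <= #|K| by apply: ltnW.
apply: (@boxicity_le_card R K T lo hi) => [v [i [j|x]]|u v uv].
- exact: ab_le.
- by rewrite /lo /hi /=; case: ifP; rewrite ?lexx ?ler0n.
split=> [/adjP adj_p [i [j|x]]|meet].
- apply: (iffLR (ab_adj i _ _ _) (adj_p i)).
  (* [ab_adj] asks for distinct projections; equal ones would form a loop. *)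
  by apply: contraTneq (adj_p i) => ->; rewrite adj_irr.
- rewrite /lo /hi /=; have := c_col i _ _ (adj_p i).
  (* At most one of [u], [v] has colour [x], so the other one has the full interval. *)
  have [->|_] := eqVneq (c i (p i u)) x.
    by rewrite eq_sym => /negPf ->; rewrite ler0n ler_nat rank_le.
  by case: ifP; rewrite ?ler0n ?ler_nat ?rank_le.
apply/adjP => i; have [pE|p_neq] := eqVneq (p i u) (p i v); last first.
  by apply: (iffRL (ab_adj i _ _ p_neq)) => j; exact: meet (Tagged _ (inl j)).
(* Equal projections share this colour, so both intervals are points; meeting forces equal ranks,
   against [u != v]. *)
move: (meet (Tagged _ (inr (c i (p i u))))).
rewrite /lo /hi /= -pE eqxx !ler_nat -eqn_leq => /eqP/val_inj/enum_rank_inj uE.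
by rewrite uE eqxx in uv.
Qed.

Theorem corollary10 (R : realType) (d : nat) (G : 'I_d.+1 -> sgraph) :
  (boxicity R (iter_direct_product G)
     <= \sum_(i < d.+1) (boxicity R (G i) + chromatic_number (G i)))%N.
Proof.
have [E [adjE E_proj]] := iter_direct_product_adj G.
apply: (@boxicity_le_sum_factors R _ G _ (fun i => projT1 (cid (E_proj i)))).
move=> u v; rewrite adjE.
by split=> Euv i; move: (Euv i); rewrite (projT2 (cid (E_proj i))).
Qed.
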